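(* Let $\lambda^\star\in\arg\min_{\lambda>0}R(\lambda)$. If the following curvature test holds at $\lambda^\star$: $$D(\lambda^\star)<\frac{(\lambda^\star)^2}{2}\,R''(\lambda^\star),$$ then $R^\star_{\mathrm{sd}}$ has negative curvature at $\lambda^\star$ (i.e. $(R^\star_{\mathrm{sd}})''(\lambda^\star)<0$), and, consequently, $$\min_{\lambda>0}R^\star_{\mathrm{sd}}(\lambda)<\min_{\lambda>0}R(\lambda).$$
   Context: Let $\mathcal D=(X,y)$ be training data with $X\in\mathbb R^{n\times p}$ (rows $x_i^\top$) and $y\in\mathbb R^n$; no distributional assumption is made on $\mathcal D$ (other than the existence of second moments), and all statements hold conditionally on $\mathcal D$ (with probability one). For $\lambda>0$ the teacher ridge predictor is $f_\lambda(x)=x^\top\arg\min_{\beta\in\mathbb R^p}\{\|y-X\beta\|_2^2/n+\lambda\|\beta\|_2^2\}$. Let $\hat y_\lambda=f_\lambda(X)=(f_\lambda(x_1),\dots,f_\lambda(x_n))^\top$. The pure-distilled predictor $f_{\mathrm{pd},\lambda}$ is the ridge predictor trained on $(X,\hat y_\lambda)$ with the same penalty $\lambda$, i.e. $f_{\mathrm{pd},\lambda}(x)=x^\top\arg\min_{\beta}\{\|\hat y_\lambda-X\beta\|_2^2/n+\lambda\|\beta\|_2^2\}$. For $\xi\in\mathbb R$ the self-distilled predictor is $$f_{\mathrm{sd},\lambda,\xi}(x)=x^\top\arg\min_{\beta\in\mathbb R^p}\{(1-\xi)\|y-X\beta\|_2^2/n+\xi\|\hat y_\lambda-X\beta\|_2^2/n+\lambda\|\beta\|_2^2\}.$$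 Let $(x_0,y_0)\in\mathbb R^p\times\mathbb R$ be a test point (possibly out-of-distribution, not necessarily independent of $\mathcal D$) with $\mathbb E[y_0^2\mid\mathcal D]<\infty$ and $\mathbb E[\|x_0\|_2^2\mid\mathcal D]<\infty$. For a predictor $f$ set $R(f)=\mathbb E[(y_0-f(x_0))^2\mid\mathcal D]$. Write $R(\lambda)=R(f_\lambda)$ (a smooth function of $\lambda>0$), $R^\star_{\mathrm{sd}}(\lambda)=\min_{\xi\in\mathbb R}R(f_{\mathrm{sd},\lambda,\xi})$, and $D(\lambda)=\mathbb E[(f_\lambda(x_0)-f_{\mathrm{pd},\lambda}(x_0))^2\mid\mathcal D]$.
   Formalization: The claim that R*_sd has a negative second derivative at λ* is proved when D(λ* )>0; when D(λ* )=0, R*_sd can be discontinuous there and the claim fails, so it is replaced by second difference quotients tending to −∞. Minima over λ>0 are stated as infima. *)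

(* Defs.v *)
From mathcomp Require Import all_boot all_order all_algebra.
From mathcomp Require Import all_classical all_reals all_analysis.
Import Order.TTheory GRing.Theory Num.Theory numFieldNormedType.Exports.

Set Implicit Arguments.
Unset Strict Implicit.
Unset Printing Implicit Defensive.

Local Open Scope classical_set_scope.
Local Open Scope ring_scope.

(* The Euclidean norm squared; the library norm on matrices is the sup norm. *)
Definition sqnorm (R : realType) (m : nat) (v : 'cV[R]_m) : R :=
  \sum_(i < m) v i 0 ^+ 2.

Definition argmin_on (R : realType) (U : Type) (A : set U) (F : U -> R) :
    set U :=
  [set u | A u /\ forall v, A v -> F u <= F v].

Section Predictors.
Context {R : realType} {n p : nat}.
Implicit Types (X : 'M[R]_(n, p)) (y : 'cV[R]_n) (b x : 'cV[R]_p).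
Implicit Types (l xi : R).

Definition linear_predictor b (x : 'cV[R]_p) : R := (x^T *m b) 0 0.

(* A chosen minimizer. For l > 0 the objectives below are strictly convex and
   coercive (for sd_objective, the coefficients 1 - xi and xi sum to 1, so
   this holds for every real xi), hence the minimizer is unique. *)
Definition minimizer (F : 'cV[R]_p -> R) : 'cV[R]_p :=
  xget 0 (argmin_on setT F).

Definition ridge_objective X y l b : R :=
  sqnorm (y - X *m b) / n%:R + l * sqnorm b.

Definition ridge X y l : 'cV[R]_p -> R :=
  linear_predictor (minimizer (ridge_objective X y l)).

Definition fitted X (f : 'cV[R]_p -> R) : 'cV[R]_n :=
  \col_(i < n) f (row i X)^T.

Definition pd_ridge X y l : 'cV[R]_p -> R :=
  ridge X (fitted X (ridge X y l)) l.

Definition sd_objective X y l xi b : R :=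
  (1 - xi) * (sqnorm (y - X *m b) / n%:R)
  + xi * (sqnorm (fitted X (ridge X y l) - X *m b) / n%:R)
  + l * sqnorm b.

Definition sd_ridge X y l xi : 'cV[R]_p -> R :=
  linear_predictor (minimizer (sd_objective X y l xi)).

End Predictors.

(* The training data (X, y) are fixed and P plays the role of the conditional
   distribution given these data, so that 'E_P is the conditional expectation.
   Since (X, y), P, x0, y0 are arbitrary, any dependence between the test point
   and the training data is allowed. *)
Section Risks.
Context {d : measure_display} {T : measurableType d} {R : realType}.
Context {n p : nat}.
Variables (P : probability T R) (x0 : T -> 'cV[R]_p) (y0 : T -> R).
Variables (X : 'M[R]_(n, p)) (y : 'cV[R]_n).

Definition risk (f : 'cV[R]_p -> R) : R :=
  fine 'E_P[fun w => (y0 w - f (x0 w)) ^+ 2].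

Definition ridge_risk (l : R) : R := risk (ridge X y l).

(* xi |-> risk (sd_ridge X y l xi) is a nonnegative polynomial of degree at
   most 2, so this infimum is a minimum. *)
Definition sd_risk_opt (l : R) : R :=
  inf [set risk (sd_ridge X y l xi) | xi in [set: R]].

Definition discrepancy (l : R) : R :=
  fine 'E_P[fun w => (ridge X y l (x0 w) - pd_ridge X y l (x0 w)) ^+ 2].

End Risks.

(* derive1 and derive1n are total operators (with a junk value where the limit
   does not exist), so differentiability has to be asserted separately. *)
Definition twice_derivable_at (R : realType) (f : R -> R) (x : R) : Prop :=
  (\forall z \near x, derivable f z 1) /\ derivable (derive1 f) x 1.

Definition second_difference (R : realType) (f : R -> R) (x h : R) : R :=
  (f (x + h) - 2 * f x + f (x - h)) / h ^+ 2.

(* Main.v *)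
Require Import Defs.
From mathcomp Require Import all_boot all_order all_algebra.
From mathcomp Require Import all_classical all_reals all_analysis.
From mathcomp Require Import measurable_realfun ring lra.
Import Order.TTheory GRing.Theory Num.Theory numFieldNormedType.Exports.

Set Implicit Arguments.
Unset Strict Implicit.
Unset Printing Implicit Defensive.

Local Open Scope classical_set_scope.
Local Open Scope ring_scope.

(** Write S = X^T X / n, c = X^T y / n, w(l) = (S + l)^-1 c for the ridge
    coefficients and u(l) = (S + l)^-1 w(l) = - w'(l). The normal equations
    give the pure-distilled coefficients w - l u = w + l w' and the
    self-distilled ones w - xi l u = w + xi l w': self-distillation moves the
    teacher along the tangent of the ridge path ([sd_ridgeE], [pd_ridgeE]).

    The risk of a linear predictor is a quadratic function of its coefficients
    ([second_moment_quadratic]), so moving along the tangent gives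
      risk(sd_{l,xi}) = R(l) + xi l R'(l) + xi^2 D(l)
    with D the discrepancy ([path_risk_drift]). The remaining argument is
    one-variable calculus about this expression ([curvature_test]), at a
    minimizer a of R, where R'(a) = 0 and the test forces R''(a) > 0:
    - if D(a) > 0, then near a the optimal risk is R - l^2 R'^2 / (4 D), whose
      second derivative at a is R''(a) (1 - a^2 R''(a) / (2 D(a))) < 0;
    - if D(a) = 0, then D = O((l - a)^2) because D >= 0, while R' is of exact
      order l - a, so that the gain stays above a positive constant as l -> a,
      l <> a, although it is zero at a: the second difference tends to -oo;
    - in both cases, the mixing weight xi = - (l - a) / a gives at l a risk
      R(a) + (l - a)^2 (D(a) / a^2 - R''(a) / 2 + o(1)), which is below R(a)
      for l close to a.

    All functions of l that occur are rational near every l > 0, by Cramer's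
    rule. Working with the class [rational_at] of functions that coincide near
    a point with a quotient of polynomials makes differentiability of every
    order automatic, and makes Taylor expansion with a regular remainder a
    matter of factoring polynomials ([rational_at_taylor2]). *)

(** * Germs of rational functions *)

Section RationalGerms.
Context {R : realType}.
Implicit Types (a c : R) (f g k : R -> R) (p q : {poly R}).

Definition rational_at a f : Prop :=
  exists p q, q.[a] != 0 /\ \forall z \near a, f z = p.[z] / q.[z].

Lemma horner_near_neq0 q a : q.[a] != 0 -> \forall z \near a, q.[z] != 0.
Proof.
exact: (cvgr_neq0 _ (@continuous_horner _ q a)).
Qed.

Lemma rational_at_near a f g :
  (\forall z \near a, f z = g z) -> rational_at a f -> rational_at a g.
Proof.
move=> fg [p [q [qa fE]]]; exists p, q; split => //.
by near=> z; rewrite -(near fg z)//; near: z.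
Unshelve. all: by end_near. Qed.

(** This openness is what makes the derivative of a rational germ, taken at
    all the neighbouring points, a rational germ again. *)
Lemma rational_at_nearby a f :
  rational_at a f -> \forall z \near a, rational_at z f.
Proof.
move=> [p [q [qa fE]]]; near=> z; exists p, q; split.
  by near: z; exact: horner_near_neq0.
by near: z; exact: nbhs_interior.
Unshelve. all: by end_near. Qed.

Lemma rational_at_horner a p : rational_at a (horner p).
Proof.
exists p, 1; rewrite hornerC oner_neq0; split => //.
by near=> z; rewrite hornerC divr1.
Unshelve. all: by end_near. Qed.

Lemma rational_at_cst a c : rational_at a (fun=> c).
Proof.
apply: rational_at_near (rational_at_horner a c%:P).
by near=> z; rewrite hornerC.
Unshelve. all: by end_near. Qed.

Lemma rational_at_id a : rational_at a id.
Proof.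
apply: rational_at_near (rational_at_horner a 'X).
by near=> z; rewrite hornerX.
Unshelve. all: by end_near. Qed.

Lemma rational_atD a f g : rational_at a f -> rational_at a g ->
  rational_at a (fun z => f z + g z).
Proof.
move=> [p [q [qa fE]]] [r [s [sa gE]]].
exists (p * s + r * q), (q * s); split; first by rewrite hornerM mulf_neq0.
near=> z.
rewrite (near fE z)// (near gE z)// !hornerE addf_div //.
  by near: z; exact: horner_near_neq0.
by near: z; exact: horner_near_neq0.
Unshelve. all: by end_near. Qed.

Lemma rational_atM a f g : rational_at a f -> rational_at a g ->
  rational_at a (fun z => f z * g z).
Proof.
move=> [p [q [qa fE]]] [r [s [sa gE]]].
exists (p * r), (q * s); split; first by rewrite hornerM mulf_neq0.
by near=> z; rewrite (near fE z)// (near gE z)// !hornerM mulf_div.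
Unshelve. all: by end_near. Qed.

Lemma rational_atN a f : rational_at a f -> rational_at a (fun z => - f z).
Proof.
move=> /(rational_atM (rational_at_cst a (-1))).
by apply: rational_at_near; near=> z; rewrite mulN1r.
Unshelve. all: by end_near. Qed.

Lemma rational_atB a f g : rational_at a f -> rational_at a g ->
  rational_at a (fun z => f z - g z).
Proof. by move=> rf /rational_atN; exact: rational_atD. Qed.

Lemma rational_atX a f n : rational_at a f -> rational_at a (fun z => f z ^+ n).
Proof.
move=> rf; elim: n => [|n /(rational_atM rf)]; first exact: rational_at_cst.
by apply: rational_at_near; near=> z; rewrite exprS.
Unshelve. all: by end_near. Qed.

Lemma rational_atV a f : rational_at a f -> f a != 0 ->
  rational_at a (fun z => (f z)^-1).
Proof.
move=> [p [q [qa fE]]] fa; exists q, p; split.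
  by move: fa; rewrite (nbhs_singleton fE) mulf_eq0 negb_or => /andP[].
by near=> z; rewrite (near fE z)// invf_div.
Unshelve. all: by end_near. Qed.

Lemma rational_at_sum a (I : Type) (r : seq I) (F : I -> R -> R) :
  (forall i, rational_at a (F i)) -> rational_at a (fun z => \sum_(i <- r) F i z).
Proof.
move=> rF; elim: r => [|i r IH].
  apply: rational_at_near (rational_at_cst a 0).
  by near=> z; rewrite big_nil.
apply: rational_at_near (rational_atD (rF i) IH).
by near=> z; rewrite big_cons.
Unshelve. all: by end_near. Qed.

Lemma rational_at_is_derive a f p q : q.[a] != 0 ->
  (\forall z \near a, f z = p.[z] / q.[z]) ->
  is_derive a 1 f ((p^`().[a] * q.[a] - p.[a] * q^`().[a]) / q.[a] ^+ 2).
Proof.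
move=> qa fE; apply: (@near_eq_is_derive _ _ _ (fun z => p.[z] * (q.[z])^-1)).
  by near=> z; rewrite (near fE z).
have dq : is_derive a (1 : R) (fun z => (q.[z])^-1) (- q.[a] ^- 2 *: q^`().[a]).
  apply: DeriveDef; first by apply: derivableV => //; exact: derivable_horner.
  by rewrite deriveV ?derive_val//; exact: derivable_horner.
apply: (is_derive_eq (is_deriveM (is_derive_poly p a) dq)).
by rewrite /GRing.scale /=; field.
Unshelve. all: by end_near. Qed.

Lemma rational_at_derivable a f : rational_at a f -> derivable f a 1.
Proof.
by move=> [p [q [qa fE]]]; have [] := rational_at_is_derive qa fE.
Qed.

Lemma rational_at_continuous a f : rational_at a f -> {for a, continuous f}.
Proof.
by move=> /rational_at_derivable /derivable1_diffP /differentiable_continuous.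
Qed.

Lemma rational_at_derive1 a f : rational_at a f -> rational_at a (derive1 f).
Proof.
move=> [p [q [qa fE]]].
exists (p^`() * q - p * q^`()), (q ^+ 2); split.
  by rewrite horner_exp expf_neq0.
near=> z.
have qz : q.[z] != 0 by near: z; exact: horner_near_neq0.
have fEz : \forall t \near z, f t = p.[t] / q.[t] by near: z; exact: nbhs_interior.
rewrite derive1E (@derive_val _ _ _ _ _ _ _ (rational_at_is_derive qz fEz)).
by rewrite !hornerE.
Unshelve. all: by end_near. Qed.

Lemma rational_at_twice_derivable a f :
  rational_at a f -> twice_derivable_at f a.
Proof.
move=> rf; split; last exact/rational_at_derivable/rational_at_derive1.
near=> z; apply: rational_at_derivable.
by near: z; exact: rational_at_nearby.
Unshelve. all: by end_near. Qed.

(** The numerator of f z - f a vanishes at a, hence is divisible by X - a: the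
    difference quotient of a rational germ extends to a rational germ. *)
Lemma rational_at_slope a f : rational_at a f -> exists2 g, rational_at a g &
  \forall z \near a, f z = f a + (z - a) * g z.
Proof.
move=> [p [q [qa fE]]]; pose N := q.[a] *: p - p.[a] *: q.
have /factor_theorem [r rE] : root N a.
  by rewrite rootE !hornerE mulrC subrr.
exists (fun z => r.[z] / (q.[a] * q.[z])).
  exists r, (q.[a] *: q); rewrite hornerZ mulf_neq0//; split => //.
  by near=> z; rewrite hornerZ.
near=> z.
have qz : q.[z] != 0 by near: z; exact: horner_near_neq0.
have : N.[z] = r.[z] * (z - a) by rewrite rE !hornerE.
rewrite /N !hornerE => NE.
rewrite (near fE z)// (nbhs_singleton fE) /=.
transitivity (p.[a] / q.[a] + (r.[z] * (z - a)) / (q.[a] * q.[z])).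
  by rewrite -NE; field; rewrite qz qa.
by congr (_ + _); ring.
Unshelve. all: by end_near. Qed.

Lemma derive1_of_slope a c f g : rational_at a g ->
  (\forall z \near a, f z = c + (z - a) * g z) -> derive1 f a = g a.
Proof.
move=> rg fE; rewrite derive1E.
apply: (@derive_val _ _ _ _ _ _ _ (near_eq_is_derive (f := fun z => c + (z - a) * g z) _ _)).
  by near=> z; rewrite (near fE z).
have dg : is_derive a (1 : R) g ('D_1 g a).
  by apply: DeriveDef => //; exact: rational_at_derivable.
have dz : is_derive a (1 : R) (fun z : R => z - a) 1.
  by apply: is_derive_eq; rewrite subr0.
apply: (is_derive_eq (is_deriveD (is_derive_cst c a 1) (is_deriveM dz dg))).
by rewrite /GRing.scale /=; ring.
Unshelve. all: by end_near. Qed.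

(** Differentiating once more an expansion whose remainder k is itself
    differentiable identifies its coefficients; for an arbitrary k the existence
    of the expansion would not make f twice differentiable. *)
Lemma derive1n2_of_expansion a c0 c1 f k : rational_at a k ->
  (\forall z \near a, f z = c0 + c1 * (z - a) + (z - a) ^+ 2 * k z) ->
  derive1 f a = c1 /\ derive1n 2 f a = 2 * k a.
Proof.
move=> rk fE; pose g z := c1 + (z - a) * k z.
have rza : rational_at a (fun z => z - a).
  exact: rational_atB (rational_at_id a) (rational_at_cst a a).
have rg : rational_at a g.
  exact: rational_atD (rational_at_cst a c1) (rational_atM rza rk).
have fgE : \forall z \near a, f z = c0 + (z - a) * g z.
  by near=> z; rewrite (near fE z)// /g; ring.
split; first by rewrite (derive1_of_slope rg fgE) /g subrr mul0r addr0.
have g'a : derive1 g a = k a.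
  by apply: (derive1_of_slope (c := c1) rk); near=> z.
have f'E : \forall z \near a,
    derive1 f z = c1 + (z - a) * (k z + derive1 g z).
  near=> z.
  have fgEz : \forall t \near z, f t = c0 + (t - a) * g t.
    by near: z; exact: nbhs_interior.
  have dg : is_derive z (1 : R) g (derive1 g z).
    rewrite derive1E; apply: DeriveDef => //; apply: rational_at_derivable.
    by near: z; exact: rational_at_nearby.
  have dz : is_derive z (1 : R) (fun t : R => t - a) 1.
    by apply: is_derive_eq; rewrite subr0.
  have df : is_derive z (1 : R) f (g z + (z - a) * derive1 g z).
    apply: (near_eq_is_derive (f := fun t => c0 + (t - a) * g t)).
      by near=> t; rewrite (near fgEz t).
    apply: (is_derive_eq (is_deriveD (is_derive_cst c0 z 1) (is_deriveM dz dg))).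
    by rewrite /GRing.scale /=; ring.
  by rewrite [LHS]derive1E derive_val /g; ring.
rewrite /derive1n /= (derive1_of_slope _ f'E); first by rewrite g'a; ring.
exact: rational_atD rk (rational_at_derive1 rg).
Unshelve. all: by end_near. Qed.

(** Two successive extractions of a difference quotient. *)
Lemma rational_at_taylor2 a f : rational_at a f ->
  exists k, [/\ rational_at a k, derive1n 2 f a = 2 * k a &
    \forall z \near a, f z = f a + derive1 f a * (z - a) + (z - a) ^+ 2 * k z].
Proof.
move=> /rational_at_slope [g rg fE]; have [k rk gE] := rational_at_slope rg.
have fE2 : \forall z \near a, f z = f a + g a * (z - a) + (z - a) ^+ 2 * k z.
  by near=> z; rewrite (near fE z)// (near gE z)//; ring.
have [f'a f''a] := derive1n2_of_expansion rk fE2.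
by exists k; rewrite f''a f'a.
Unshelve. all: by end_near. Qed.

(** Fermat's rule. *)
Lemma rational_at_local_min a f : rational_at a f ->
  (\forall z \near a, f a <= f z) -> derive1 f a = 0.
Proof.
move=> rf fmin.
have /nbhs_ballP[e /= e0 aeP] :
    \forall z \near a, derivable f z 1 /\ f a <= f z.
  near=> z; split; last by near: z.
  by apply: rational_at_derivable; near: z; exact: rational_at_nearby.
have P t : t \in `]a - e, a + e[ -> derivable f t 1 /\ f a <= f t.
  rewrite in_itv/= => /andP[t1 t2]; apply: aeP.
  by rewrite /ball/= ltr_norml; apply/andP; split; lra.
rewrite derive1E; apply: (@derive_val _ _ _ _ _ _ _ (derive1_at_min (a := a - e) (b := a + e) _ _ _ _)).
- by lra.
- by move=> t /P[].
- by rewrite in_itv/=; apply/andP; split; lra.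
- by move=> t /P[].
Unshelve. all: by end_near. Qed.

End RationalGerms.

(** * The curvature test for a risk that is quadratic in the mixing weight *)

Lemma inf_eq_min (R : realType) (A : set R) (m : R) :
  A m -> (forall x, A x -> m <= x) -> inf A = m.
Proof.
move=> Am lbm; apply/eqP; rewrite eq_le; apply/andP; split.
  by apply: ge_inf => //; exists m.
by apply: lb_le_inf => //; exists m.
Qed.

(** The vertex of the parabola is at xi = - B / (2 D). *)
Lemma inf_quadratic (R : realType) (A B D : R) : 0 < D ->
  inf [set A + xi * B + xi ^+ 2 * D | xi in [set: R]] = A - B ^+ 2 / (4 * D).
Proof.
move=> D0; have Dn0 : D != 0 by rewrite gt_eqF.
apply: inf_eq_min => [|_ [xi _ <-]].
  by exists (- B / (2 * D)) => //; field.
rewrite -subr_ge0 (_ : _ - _ = D * (xi + B / (2 * D)) ^+ 2); last by field.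
by rewrite mulr_ge0 ?sqr_ge0// ltW.
Qed.

(** If f has an isolated upward jump of size at least c at a, then the numerator
    of the second difference stays below - 2 c while its denominator vanishes. *)
Lemma second_difference_cvgNy (R : realType) (f : R -> R) (a c : R) : 0 < c ->
  (\forall z \near a, z != a -> f z <= f a - c) ->
  second_difference f a h @[h --> 0^'] --> -oo.
Proof.
move=> c0 /nbhs_ballP[e /= e0 aeP].
apply/cvgrNyPle => M.
(* For |h| < 1 one has h^2 <= |h|, so |h| < d is enough to push the quotient
   - 2 c / h^2 below M. *)
pose d := 2 * c / (`|M| + 1).
have d0 : 0 < d by rewrite divr_gt0 ?mulr_gt0// ltr_wpDl.
near=> h.
have h0 : h != 0 by near: h; exact: nbhs_dnbhs_neq.
have hh : 0 < h ^+ 2 by rewrite exprn_even_gt0.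
have he : `|h| < e by near: h; exact: dnbhs0_lt.
have h1 : `|h| < 1 by near: h; exact: dnbhs0_lt.
have hd : `|h| < d by near: h; exact: dnbhs0_lt.
have fp : f (a + h) <= f a - c.
  apply: aeP; first by rewrite /ball/= opprD addNKr normrN.
  by rewrite -subr_eq0 addrC addKr.
have fm : f (a - h) <= f a - c.
  apply: aeP; first by rewrite /ball/= opprB addrC subrK.
  by rewrite -subr_eq0 addrC addKr oppr_eq0.
rewrite /second_difference ler_pdivrMr//.
apply: (@le_trans _ _ (- (2 * c))); first by lra.
have : `|M| * h ^+ 2 <= 2 * c.
  have M1 : 0 < `|M| + 1 by rewrite ltr_wpDl.
  have : h ^+ 2 <= d.
    rewrite -real_normK ?num_real// (le_trans _ (ltW hd))// expr2.
    by rewrite ler_piMl// ltW.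
  rewrite /d ler_pdivlMr// mulrC; apply: le_trans.
  by rewrite ler_wpM2r ?sqr_ge0// lerDl.
have := ler_norm (- M); rewrite normrN => NM.
have : - M * h ^+ 2 <= `|M| * h ^+ 2 by rewrite ler_wpM2r ?sqr_ge0.
by lra.
Unshelve. all: by end_near. Qed.

Section CurvatureTest.
Context {R : realType}.
(** Here r is the teacher's risk, D the discrepancy, q l xi the risk at penalty l
    and mixing weight xi, and a the minimizer of r. *)
Variables (r D : R -> R) (q : R -> R -> R) (a : R).
Hypotheses (a0 : 0 < a) (rr : rational_at a r) (rD : rational_at a D).
Hypothesis rmin : forall l, 0 < l -> r a <= r l.
Hypothesis D_ge0 : forall l, 0 <= D l.
Hypothesis q_ge0 : forall l xi, 0 <= q l xi.
Hypothesis qE : forall l xi, 0 < l ->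
  q l xi = r l + xi * (l * derive1 r l) + xi ^+ 2 * D l.
Hypothesis test : D a < a ^+ 2 / 2 * derive1n 2 r a.

Let s l := inf [set q l xi | xi in [set: R]].

Let near_gt0 : \forall z \near a, 0 < z.
Proof. exact: lt_nbhsr. Qed.

Let r'a : derive1 r a = 0.
Proof.
apply: rational_at_local_min => //.
by near=> z; apply: rmin; near: z.
Unshelve. all: by end_near. Qed.

Let s_le l xi : s l <= q l xi.
Proof. by apply: ge_inf; [exists 0 => _ [t _ <-]|exists xi]. Qed.

Let rz : rational_at a (fun z => z - a).
Proof. exact: rational_atB (rational_at_id a) (rational_at_cst a a). Qed.

Let s_a : s a = r a.
Proof.
apply: inf_eq_min => [|_ [xi _ <-]]; first by exists 0 => //; rewrite qE//; ring.
by rewrite qE// r'a !mulr0 addr0 lerDl mulr_ge0 ?sqr_ge0.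
Qed.

Let r''a_gt0 : 0 < derive1n 2 r a.
Proof.
have := le_lt_trans (D_ge0 a) test.
by rewrite pmulr_rgt0// divr_gt0// exprn_gt0.
Qed.

(** Since r'(a) = 0, the excess r - r(a) has a double zero at a and r' a simple
    one. *)
Let r_expand : exists k g, [/\ rational_at a k, rational_at a g,
  k a = derive1n 2 r a / 2, g a = derive1n 2 r a &
  \forall z \near a, r z = r a + (z - a) ^+ 2 * k z /\
    derive1 r z = (z - a) * g z].
Proof.
have [k [rk k_a kE]] := rational_at_taylor2 rr.
have [g rg gE] := rational_at_slope (rational_at_derive1 rr).
have g_a := derive1_of_slope rg gE.
exists k, g; split => //; first by rewrite k_a; field.
near=> z; rewrite (near kE z)// (near gE z)// r'a mul0r addr0 add0r.
by [].
Unshelve. all: by end_near. Qed.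

(** The optimal gain l^2 r'^2 / (4 D) has a double zero at a, so s has an
    expansion with vanishing linear part and the remainder h below. *)
Let regular : 0 < D a -> twice_derivable_at s a /\ derive1n 2 s a < 0.
Proof.
move=> Da.
have [k [g [rk rg k_a g_a rE]]] := r_expand.
pose h z := k z - z ^+ 2 * g z ^+ 2 * (4 * D z)^-1.
have rh : rational_at a h.
  apply: rational_atB => //; apply: rational_atM.
    by apply: rational_atM; apply: rational_atX => //; exact: rational_at_id.
  apply: rational_atV; last by rewrite mulf_neq0// gt_eqF.
  exact: rational_atM (rational_at_cst a 4) rD.
have nD : \forall z \near a, 0 < D z.
  exact: (cvgr_gt _ (rational_at_continuous rD)).
have sE : \forall z \near a, s z = r a + 0 * (z - a) + (z - a) ^+ 2 * h z.
  near=> z.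
  have z0 : 0 < z by near: z.
  have Dz : 0 < D z by near: z.
  have [rzE r'zE] : r z = r a + (z - a) ^+ 2 * k z /\
    derive1 r z = (z - a) * g z by near: z.
  have -> : s z = r z - (z * derive1 r z) ^+ 2 / (4 * D z).
    by rewrite -inf_quadratic//; congr inf; apply: eq_imagel => xi _; exact: qE.
  by rewrite rzE r'zE /h; field; rewrite gt_eqF.
have rs : rational_at a s.
  apply: (@rational_at_near _ _ (fun z => r a + (z - a) ^+ 2 * h z)).
    by near=> z; rewrite (near sE z)//; ring.
  apply: rational_atD; first exact: rational_at_cst.
  by apply: rational_atM => //; exact: rational_atX.
split; first exact: rational_at_twice_derivable.
have [_ ->] := derive1n2_of_expansion rh sE.
rewrite /h k_a g_a; set w := derive1n 2 r a.
have -> : 2 * (w / 2 - a ^+ 2 * w ^+ 2 * (4 * D a)^-1) =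
    (w / D a) * (D a - a ^+ 2 / 2 * w) by field; rewrite gt_eqF.
by rewrite pmulr_rlt0 ?subr_lt0// divr_gt0.
Unshelve. all: by end_near. Qed.

(** Both D and r'^2 have a double zero at a, so the weight xi = - t / (z - a)
    turns the parabola into r(a) - t a r''(a) + t^2 j(a) + o(1), with 2 j(a) the
    second derivative of D; a small enough t > 0 makes this less than r(a). *)
Let degenerate : D a = 0 -> second_difference s a h @[h --> 0^'] --> -oo.
Proof.
move=> Da.
have [k [g [rk rg k_a g_a rE]]] := r_expand.
have [j [rj _ DE]] := rational_at_taylor2 rD.
have D'a : derive1 D a = 0.
  by apply: rational_at_local_min => //; near=> z; rewrite Da.
pose w := derive1n 2 r a.
(* This t satisfies t |j a| <= a w / 2, so at least half of the linear term
   t a w survives; the threshold t a w / 4 leaves room for the o(1). *)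
pose t := a * w / (2 * (`|j a| + 1)).
have j1 : 0 < `|j a| + 1 by rewrite ltr_wpDl.
have t0 : 0 < t by rewrite divr_gt0 ?mulr_gt0.
pose h z := (z - a) ^+ 2 * k z - t * (z * g z) + t ^+ 2 * j z.
have rh : rational_at a h.
  apply: rational_atD; last exact: rational_atM (rational_at_cst a _) rj.
  apply: rational_atB; first by apply: rational_atM => //; exact: rational_atX.
  apply: rational_atM; first exact: rational_at_cst.
  by apply: rational_atM => //; exact: rational_at_id.
have ha : h a < - (t * (a * w) / 4).
  have tj : t * j a <= a * w / 2.
    apply: (@le_trans _ _ (t * (`|j a| + 1))).
      by rewrite ler_pM2l// (le_trans (ler_norm _))// lerDl.
    rewrite /t le_eqVlt; apply/orP; left; apply/eqP; field.
    by rewrite gt_eqF.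
  rewrite /h subrr g_a -/w.
  have : t * (t * j a) <= t * (a * w / 2) by rewrite ler_pM2l.
  have : 0 < t * (a * w) by rewrite !mulr_gt0.
  by lra.
apply: (@second_difference_cvgNy _ _ _ (t * (a * w) / 4)).
  by rewrite divr_gt0 ?mulr_gt0.
have hlt := cvgr_lt _ (rational_at_continuous rh) _ ha.
near=> z => za.
have z0 : 0 < z by near: z.
have zan0 : z - a != 0 by rewrite subr_eq0.
have [rzE r'zE] : r z = r a + (z - a) ^+ 2 * k z /\
    derive1 r z = (z - a) * g z by near: z.
have DzE : D z = (z - a) ^+ 2 * j z.
  by rewrite (near DE z)// Da D'a mul0r !add0r.
have hz : h z < - (t * (a * w) / 4) by near: z; exact: hlt.
rewrite s_a; apply: le_trans (s_le z (- t / (z - a))) _.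
rewrite qE// rzE r'zE DzE.
suff -> : r a + (z - a) ^+ 2 * k z + - t / (z - a) * (z * ((z - a) * g z))
    + (- t / (z - a)) ^+ 2 * ((z - a) ^+ 2 * j z) = r a + h z by lra.
by rewrite /h; field.
Unshelve. all: by end_near. Qed.

(** The weight xi = - (z - a) / a covers D(a) = 0 and D(a) > 0 alike: it is of
    order z - a, as is r', so the parabola takes the value r(a) + (z - a)^2 h(z)
    where h(a) = r''(a) / 2 - r''(a) + D(a) / a^2, which is negative by the
    curvature test. *)
Let strict_gain : exists2 z, 0 < z & s z < r a.
Proof.
have [k [g [rk rg k_a g_a rE]]] := r_expand.
pose h z := k z - z / a * g z + D z / a ^+ 2.
have rh : rational_at a h.
  apply: rational_atD; last exact: rational_atM rD (rational_at_cst a _).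
  apply: rational_atB => //; apply: rational_atM => //.
  exact: rational_atM (rational_at_id a) (rational_at_cst a _).
have ha : h a < 0.
  rewrite /h k_a g_a divff ?gt_eqF//; set w := derive1n 2 r a.
  have : D a / a ^+ 2 < w / 2.
    by rewrite ltr_pdivrMr ?exprn_gt0//; have := test; rewrite -/w; lra.
  by lra.
have hlt := cvgr_lt _ (rational_at_continuous rh) _ ha.
have : \forall z \near a^', 0 < z /\ s z < r a.
  near=> z.
  have z0 : 0 < z by near: z; exact: nbhs_dnbhs.
  have za : z != a by near: z; exact: nbhs_dnbhs_neq.
  have [rzE r'zE] : r z = r a + (z - a) ^+ 2 * k z /\
    derive1 r z = (z - a) * g z by near: z; exact: nbhs_dnbhs.
  have hz : h z < 0 by near: z; apply: nbhs_dnbhs; exact: hlt.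
  split=> //; apply: le_lt_trans (s_le z (- (z - a) / a)) _.
  rewrite qE// rzE r'zE.
  have -> : r a + (z - a) ^+ 2 * k z + - (z - a) / a * (z * ((z - a) * g z))
      + (- (z - a) / a) ^+ 2 * D z = r a + (z - a) ^+ 2 * h z.
    by rewrite /h; field; rewrite gt_eqF.
  by rewrite gtrDl pmulr_rlt0// exprn_even_gt0// subr_eq0.
by move=> /filter_ex[z [z0 sz]]; exists z.
Unshelve. all: by end_near. Qed.

Lemma curvature_test :
  [/\ 0 < D a -> twice_derivable_at s a /\ derive1n 2 s a < 0,
      D a = 0 -> second_difference s a h @[h --> 0^'] --> -oo
    & inf [set s l | l in [set l : R | 0 < l]]
        < inf [set r l | l in [set l : R | 0 < l]]].
Proof.
split => //.
have -> : inf [set r l | l in [set l : R | 0 < l]] = r a.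
  by apply: inf_eq_min => [|_ [l l0 <-]]; [exists a|exact: rmin].
have [z z0 /(le_lt_trans _)] := strict_gain; apply; apply: ge_inf.
  exists 0 => _ [l l0 <-]; apply: lb_le_inf; first by exists (q l 0), 0.
  by move=> _ [xi _ <-].
by exists z.
Qed.

End CurvatureTest.

(** * Closed forms of the ridge, pure-distilled and self-distilled predictors *)

Section SquaredNorm.
Context {R : realType}.

Lemma sqnormE m (v : 'cV[R]_m) : sqnorm v = (v^T *m v) 0 0.
Proof. by rewrite mxE; apply: eq_bigr => i _; rewrite mxE expr2. Qed.

Lemma sqnorm_ge0 m (v : 'cV[R]_m) : 0 <= sqnorm v.
Proof. by apply: sumr_ge0 => i _; exact: sqr_ge0. Qed.

Lemma sqnorm_gt0 m (v : 'cV[R]_m) : v != 0 -> 0 < sqnorm v.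
Proof.
move=> v0; rewrite lt_neqAle sqnorm_ge0 andbT eq_sym; apply: contra v0.
rewrite psumr_eq0 => [/allP v0|i _]; last exact: sqr_ge0.
apply/eqP/colP => i; rewrite mxE; apply/eqP.
by rewrite -sqrf_eq0; apply: v0; rewrite mem_index_enum.
Qed.

Lemma sqnormB m (u v : 'cV[R]_m) :
  sqnorm (u - v) = sqnorm u - 2 * (u^T *m v) 0 0 + sqnorm v.
Proof.
rewrite /sqnorm mxE mulr_sumr -sumrB -big_split /=.
by apply: eq_bigr => i _; rewrite !mxE; ring.
Qed.

End SquaredNorm.

Section RidgeRegression.
Context {R : realType} {n p : nat}.
Implicit Types (X : 'M[R]_(n, p)) (y z : 'cV[R]_n) (b e : 'cV[R]_p).
Implicit Types (a l xi : R).

Definition gram X : 'M[R]_p := n%:R^-1 *: (X^T *m X).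

Definition resolvent X l : 'M[R]_p := invmx (gram X + l%:M).

Definition ridge_coef X y l : 'cV[R]_p :=
  resolvent X l *m (n%:R^-1 *: (X^T *m y)).

(** The opposite of the derivative of the ridge coefficients in the penalty. *)
Definition ridge_drift X y l : 'cV[R]_p := resolvent X l *m ridge_coef X y l.

Lemma minimizer_unique (F : 'cV[R]_p -> R) b :
  (forall b', b' != b -> F b < F b') -> minimizer F = b.
Proof.
move=> Fb; apply: xget_unique.
  by split=> // v _; have [->//|/Fb/ltW] := eqVneq v b.
move=> v [_ /(_ b I) vb]; apply/eqP; apply: contraTT vb => /Fb.
by rewrite -ltNge.
Qed.

(** Around a solution b of the normal equation, the objective at b - e exceeds
    the objective at b by |X e|^2 / n + l |e|^2. The weights 1 - xi and xi may be
    negative, but their sum is 1, so they cancel from the quadratic part. *)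
Lemma normal_equation_minimizer X y z l xi b : 0 < l ->
  n%:R^-1 *: (X^T *m ((1 - xi) *: y + xi *: z - X *m b)) = l *: b ->
  minimizer (fun b' => (1 - xi) * (sqnorm (y - X *m b') / n%:R)
    + xi * (sqnorm (z - X *m b') / n%:R) + l * sqnorm b') = b.
Proof.
move=> l0 bE; apply: minimizer_unique => b'.
rewrite -subr_eq0 -oppr_eq0 => e0; pose e := - (b' - b).
have -> : b' = b - e by rewrite /e opprK addrC subrK.
have sqE v : sqnorm (v - X *m (b - e)) =
    sqnorm (v - X *m b) + 2 * ((v - X *m b)^T *m (X *m e)) 0 0 + sqnorm (X *m e).
  have -> : v - X *m (b - e) = (v - X *m b) - (- (X *m e)).
    by rewrite mulmxBr opprB opprK addrA addrAC.
  rewrite sqnormB mulmxN mxE; congr (_ + _); first by ring.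
  by rewrite /sqnorm; apply: eq_bigr => i _; rewrite mxE sqrrN.
(* The terms of first order in e cancel: this is the normal equation tested
   against e. *)
have cross : (1 - xi) * ((y - X *m b)^T *m (X *m e)) 0 0 / n%:R
    + xi * ((z - X *m b)^T *m (X *m e)) 0 0 / n%:R = l * (b^T *m e) 0 0.
  have -> : l * (b^T *m e) 0 0 = ((l *: b)^T *m e) 0 0.
    by rewrite linearZ /= -scalemxAl [in RHS]mxE.
  rewrite -bE linearZ /= -scalemxAl [in RHS]mxE trmx_mul trmxK -mulmxA.
  have -> : (1 - xi) *: y + xi *: z - X *m b =
      (1 - xi) *: (y - X *m b) + xi *: (z - X *m b).
    by apply/colP => i; rewrite !mxE; ring.

  have trZ c (v : 'cV[R]_n) : (c *: v)^T = c *: v^T by rewrite linearZ.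
  rewrite [in RHS]raddfD /= !trZ mulmxDl -!scalemxAl.
  by rewrite [in RHS]mxE [X in _ * (X + _)]mxE [X in _ * (_ + X)]mxE; ring.
rewrite (sqE y) (sqE z) sqnormB -subr_gt0.
have := mulr_gt0 l0 (sqnorm_gt0 e0); rewrite -/e => le0.
have : 0 <= sqnorm (X *m e) / n%:R by rewrite divr_ge0 ?sqnorm_ge0.
move: cross le0.
set c1 := ((y - _)^T *m _) 0 0; set c2 := ((z - _)^T *m _) 0 0.
set s1 := sqnorm (y - _); set s2 := sqnorm (z - _); set s3 := sqnorm (X *m e).
set N := n%:R^-1; set s4 := sqnorm e; set s5 := sqnorm b; set c3 := (_ *m e) 0 0.
move=> cross le0 s3N.
have -> : (1 - xi) * ((s1 + 2 * c1 + s3) * N) + xi * ((s2 + 2 * c2 + s3) * N)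
   + l * (s5 - 2 * c3 + s4) - ((1 - xi) * (s1 * N) + xi * (s2 * N) + l * s5)
   = 2 * ((1 - xi) * c1 * N + xi * c2 * N) - 2 * (l * c3) + s3 * N + l * s4.
  by ring.
by rewrite cross subrr add0r ltr_wpDl.
Qed.

(** The matrix is positive definite:
    v (S + l) v^T = |X v^T|^2 / n + l |v|^2. *)
Lemma ridge_mx_unit X l : 0 < l -> gram X + l%:M \in unitmx.
Proof.
move=> l0; rewrite -row_free_unit -kermx_eq0; apply/rowV0P => v /sub_kermxP vA.
apply/eqP; rewrite -trmx_eq0; apply: contraT => /sqnorm_gt0 v0.
have : (v *m (gram X + l%:M) *m v^T) 0 0 =
    n%:R^-1 * sqnorm (X *m v^T) + l * sqnorm v^T.
  rewrite !sqnormE trmx_mul !trmxK mulmxDr mulmxDl mul_mx_scalar mxE.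
  rewrite -!scalemxAl -scalemxAr -scalemxAl.
  by rewrite [in LHS]mxE [X in _ + X]mxE !mulmxA.
rewrite vA mul0mx mxE => /esym/eqP.
rewrite gt_eqF// ltr_wpDl ?mulr_gt0//.
by rewrite mulr_ge0 ?sqnorm_ge0 ?invr_ge0.
Qed.

Lemma mulKridge_mx X l m (B : 'M[R]_(p, m)) : 0 < l ->
  (gram X + l%:M) *m (resolvent X l *m B) = B.
Proof. by move=> l0; rewrite mulKVmx// ridge_mx_unit. Qed.

Lemma gram_ridge_coef X y l : 0 < l ->
  gram X *m ridge_coef X y l =
  n%:R^-1 *: (X^T *m y) - l *: ridge_coef X y l.
Proof.
move=> l0; rewrite -[X in X - _](mulKridge_mx X _ l0) -/(ridge_coef X y l).
by rewrite mulmxDl mul_scalar_mx addrK.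
Qed.

Lemma gram_ridge_drift X y l : 0 < l ->
  gram X *m ridge_drift X y l = ridge_coef X y l - l *: ridge_drift X y l.
Proof.
move=> l0; rewrite -[X in X - _](mulKridge_mx X _ l0) -/(ridge_drift X y l).
by rewrite mulmxDl mul_scalar_mx addrK.
Qed.

(** The ridge objective is the self-distillation objective of weight 0. *)
Lemma ridgeE X y l : 0 < l ->
  ridge X y l = linear_predictor (ridge_coef X y l).
Proof.
move=> l0; congr linear_predictor.
rewrite -(@normal_equation_minimizer X y 0 l 0 (ridge_coef X y l))//.
  by congr minimizer; apply/funext => b; rewrite /ridge_objective; ring.
rewrite subr0 scale1r scale0r addr0 mulmxBr scalerBr mulmxA.
rewrite [X in _ - X]scalemxAl -/(gram X).
by rewrite gram_ridge_coef// opprB addrC subrK.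
Qed.

Lemma fitted_linear X b : fitted X (linear_predictor b) = X *m b.
Proof.
apply/colP => i; rewrite mxE /linear_predictor trmxK -row_mul.
by rewrite mxE.
Qed.

Lemma sd_ridgeE X y l xi : 0 < l ->
  sd_ridge X y l xi =
  linear_predictor (ridge_coef X y l - (xi * l) *: ridge_drift X y l).
Proof.
move=> l0; congr linear_predictor; apply: normal_equation_minimizer => //.
rewrite ridgeE// fitted_linear.
set w := ridge_coef X y l; set u := ridge_drift X y l.
have -> : n%:R^-1 *: (X^T *m ((1 - xi) *: y + xi *: (X *m w)
      - X *m (w - (xi * l) *: u))) =
    (1 - xi) *: (n%:R^-1 *: (X^T *m y)) + xi *: (gram X *m w)
      - gram X *m w + (xi * l) *: (gram X *m u).
  rewrite /gram -!scalemxAl -!mulmxA !mulmxBr mulmxDr -!scalemxAr.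
  move: (X^T *m y) (X^T *m (X *m w)) (X^T *m (X *m u)) => A B C.
  by apply/colP => i; rewrite !mxE; ring.
rewrite gram_ridge_coef// gram_ridge_drift// -/w -/u.
by move: (X^T *m y) => A; apply/colP => i; rewrite !mxE; ring.
Qed.

(** The student's right-hand side is S w(l) = (S + l) w(l) - l w(l), which the
    resolvent maps to w(l) - l u(l). *)
Lemma pd_ridgeE X y l : 0 < l ->
  pd_ridge X y l = linear_predictor (ridge_coef X y l - l *: ridge_drift X y l).
Proof.
move=> l0; rewrite /pd_ridge ridgeE// ridgeE// fitted_linear.
congr linear_predictor; rewrite [LHS]/ridge_coef mulmxA scalemxAl -/(gram X).
rewrite gram_ridge_coef// mulmxBr.
by rewrite -/(ridge_coef X y l) -scalemxAr.
Qed.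

(** The resolvent identity. *)
Lemma ridge_coef_slope X y a l : 0 < a -> 0 < l ->
  ridge_coef X y l =
  ridge_coef X y a - (l - a) *: (resolvent X l *m ridge_coef X y a).
Proof.
move=> a0 l0; apply: (can_inj (mulKmx (ridge_mx_unit X l0))).
rewrite mulKridge_mx// mulmxBr -scalemxAr mulKridge_mx//.
rewrite mulmxDl mul_scalar_mx gram_ridge_coef//.
by move: (X^T *m y) (ridge_coef X y a) => A B; apply/colP => i; rewrite !mxE; ring.
Qed.

End RidgeRegression.

(** * Rational dependence on the penalty *)

Section RationalMatrices.
Context {R : realType}.
Implicit Types (a : R).

Definition rational_mx_at a m1 m2 (A : R -> 'M[R]_(m1, m2)) : Prop :=
  forall i j, rational_at a (fun z => A z i j).

Lemma rational_mx_at_cst a m1 m2 (A : 'M[R]_(m1, m2)) :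
  rational_mx_at a (fun=> A).
Proof. by move=> i j; exact: rational_at_cst. Qed.

Lemma rational_mx_atM a m1 m2 m3 (A : R -> 'M[R]_(m1, m2))
    (B : R -> 'M[R]_(m2, m3)) :
  rational_mx_at a A -> rational_mx_at a B ->
  rational_mx_at a (fun z => A z *m B z).
Proof.
move=> rA rB i j.
apply: rational_at_near (rational_at_sum (index_enum 'I_m2)
  (fun k => rational_atM (rA i k) (rB k j))).
by near=> z; rewrite mxE.
Unshelve. all: by end_near. Qed.

Lemma rational_mx_at_tr a m1 m2 (A : R -> 'M[R]_(m1, m2)) :
  rational_mx_at a A -> rational_mx_at a (fun z => (A z)^T).
Proof.
move=> rA i j; apply: rational_at_near (rA j i).
by near=> z; rewrite mxE.
Unshelve. all: by end_near. Qed.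

Lemma rational_mx_atN a m1 m2 (A : R -> 'M[R]_(m1, m2)) :
  rational_mx_at a A -> rational_mx_at a (fun z => - A z).
Proof.
move=> rA i j; apply: rational_at_near (rational_atN (rA i j)).
by near=> z; rewrite mxE.
Unshelve. all: by end_near. Qed.

Lemma rational_mx_at_col a m1 m2 m (A : R -> 'M[R]_(m1, m))
    (B : R -> 'M[R]_(m2, m)) :
  rational_mx_at a A -> rational_mx_at a B ->
  rational_mx_at a (fun z => col_mx (A z) (B z)).
Proof.
move=> rA rB i j; case: (splitP i) => k ik.
  have -> : i = lshift m2 k by apply: val_inj.
  by apply: rational_at_near (rA k j); near=> z; rewrite col_mxEu.
have -> : i = rshift m1 k by apply: val_inj.
by apply: rational_at_near (rB k j); near=> z; rewrite col_mxEd.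
Unshelve. all: by end_near. Qed.

(** Cramer's rule: the entries of the adjugate and the determinant of the
    polynomial matrix S + 'X are polynomials, and evaluation commutes with both. *)
Lemma rational_at_resolvent n p (X : 'M[R]_(n, p)) a : 0 < a ->
  rational_mx_at a (resolvent X).
Proof.
move=> a0 i j; pose A := map_mx polyC (gram X) + 'X%:M.
have AE z : map_mx (horner_eval z) A = gram X + z%:M.
  apply/matrixP => k m; rewrite !mxE /horner_eval hornerD hornerC.
  by rewrite hornerMn hornerX.
exists (\adj A i j), (\det A).
have detE z : (\det A).[z] = \det (gram X + z%:M).
  by rewrite -AE det_map_mx.
have adjE z : (\adj A i j).[z] = \adj (gram X + z%:M) i j.
  by rewrite -AE -map_mx_adj [RHS]mxE.
split; first by rewrite detE -unitfE -unitmxE ridge_mx_unit.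
near=> z; rewrite detE adjE /resolvent /invmx ridge_mx_unit.
  by rewrite mxE mulrC.
by near: z; exact: lt_nbhsr.
Unshelve. all: by end_near. Qed.

End RationalMatrices.

(** * Second moments and quadratic risks *)

Section SecondMoments.
Context {d : measure_display} {T : measurableType d} {R : realType}.
Variable P : {measure set T -> \bar R}.

Definition square_integrable (f : T -> R) : Prop :=
  measurable_fun [set: T] f /\ P.-integrable setT (EFin \o (fun w => f w ^+ 2)).

Lemma square_integrableP (f : T -> R) : measurable_fun [set: T] f ->
  (\int[P]_w (f w ^+ 2)%:E < +oo)%E -> square_integrable f.
Proof.
move=> mf foo; split=> //; apply/integrableP; split.
  by apply/measurable_EFinP; exact: measurable_funX.
rewrite (eq_integral (fun w => (f w ^+ 2)%:E))// => w _ /=.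
by rewrite ger0_norm ?sqr_ge0.
Qed.

(** From |f g| <= f^2 + g^2. *)
Lemma square_integrableM (f g : T -> R) :
  square_integrable f -> square_integrable g ->
  P.-integrable setT (EFin \o (fun w => f w * g w)).
Proof.
move=> [mf if2] [mg ig2].
have := integrableD measurableT if2 ig2.
apply: le_integrable => //.
  by apply/measurable_EFinP; exact: measurable_funM.
move=> w _ /=; rewrite lee_fin [leRHS]ger0_norm ?addr_ge0 ?sqr_ge0//.
rewrite ler_norml; apply/andP; split; rewrite -subr_ge0.
  rewrite (_ : _ - _ = ((f w + g w) ^+ 2 + f w ^+ 2 + g w ^+ 2) / 2); last by field.
  by rewrite divr_ge0 ?addr_ge0 ?sqr_ge0.
rewrite (_ : _ - _ = ((f w - g w) ^+ 2 + f w ^+ 2 + g w ^+ 2) / 2); last by field.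
by rewrite divr_ge0 ?addr_ge0 ?sqr_ge0.
Qed.

Lemma Rintegral_sum (I : Type) (r : seq I) (F : I -> T -> R) :
  (forall i, P.-integrable setT (EFin \o F i)) ->
  P.-integrable setT (EFin \o (fun w => \sum_(i <- r) F i w)) /\
  \int[P]_w (\sum_(i <- r) F i w) = \sum_(i <- r) \int[P]_w F i w.
Proof.
move=> iF; elim: r => [|i r [iS SE]].
  have -> : (fun w => \sum_(i <- [::]) F i w) = cst 0.
    by apply/funext => w; rewrite big_nil.
  rewrite big_nil Rintegral_cst// mul0r; split => //; exact: integrable0.
have -> : (fun w => \sum_(j <- i :: r) F j w) =
    (fun w => F i w + \sum_(j <- r) F j w).
  by apply/funext => w; rewrite big_cons.
split; last by rewrite RintegralD// big_cons SE.
exact: (integrableD measurableT (iF i) iS).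
Qed.

Definition second_moment m (Z : T -> 'cV[R]_m) : 'M[R]_m :=
  \matrix_(i, j) \int[P]_w (Z w i 0 * Z w j 0).

Lemma second_moment_quadratic m (Z : T -> 'cV[R]_m) (b : 'cV[R]_m) :
  (forall i, square_integrable (fun w => Z w i 0)) ->
  \int[P]_w (((Z w)^T *m b) 0 0 ^+ 2) = (b^T *m second_moment Z *m b) 0 0.
Proof.
move=> ZL2.
have ic i j : P.-integrable setT
    (EFin \o (fun w => (b i 0 * b j 0) * (Z w i 0 * Z w j 0))).
  exact: (integrableZl measurableT _ (square_integrableM (ZL2 i) (ZL2 j))).
have E w : ((Z w)^T *m b) 0 0 ^+ 2 =
    \sum_j \sum_i (b i 0 * b j 0) * (Z w i 0 * Z w j 0).
  rewrite mxE expr2 mulr_suml exchange_big /=; apply: eq_bigr => i _.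
  by rewrite mulr_sumr; apply: eq_bigr => j _; rewrite !mxE; ring.
under eq_Rintegral do rewrite E.
rewrite (Rintegral_sum _ _).2; last first.
  by move=> j; exact: (Rintegral_sum _ (fun i => ic i j)).1.
rewrite mxE; apply: eq_bigr => j _.
rewrite (Rintegral_sum _ (fun i => ic i j)).2 mxE mulr_suml.
apply: eq_bigr => i _.
rewrite RintegralZl//; last exact: square_integrableM.
by rewrite !mxE; ring.
Qed.

Lemma second_moment_sym m (Z : T -> 'cV[R]_m) :
  (second_moment Z)^T = second_moment Z.
Proof.
apply/matrixP => i j; rewrite !mxE; apply: eq_Rintegral => w _.
by rewrite mulrC.
Qed.

End SecondMoments.

Section BilinearForm.
Context {R : realType} {m : nat}.
Variable K : 'M[R]_m.
Hypothesis K_sym : K^T = K.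
Implicit Types u v : 'cV[R]_m.

Definition bform u v : R := (u^T *m K *m v) 0 0.

Lemma bformC u v : bform u v = bform v u.
Proof.
rewrite /bform; have -> : v^T *m K *m u = (u^T *m K *m v)^T.
  by rewrite !trmx_mul trmxK K_sym mulmxA.
by rewrite [in RHS]mxE.
Qed.

Lemma bformDr u v w : bform u (v + w) = bform u v + bform u w.
Proof. by rewrite /bform mulmxDr mxE. Qed.

Lemma bformZr t u v : bform u (t *: v) = t * bform u v.
Proof. by rewrite /bform -scalemxAr mxE. Qed.

Lemma bform_line u v t : bform (u + t *: v) (u + t *: v) =
  bform u u + t * (2 * bform u v) + t ^+ 2 * bform v v.
Proof.
rewrite bformDr bformZr !(bformC (u + _)) !bformDr !bformZr (bformC v u).
by ring.
Qed.

End BilinearForm.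

Lemma rational_at_bform (R : realType) (m : nat) (K : 'M[R]_m) a
    (u v : R -> 'cV[R]_m) :
  rational_mx_at a u -> rational_mx_at a v ->
  rational_at a (fun z => bform K (u z) (v z)).
Proof.
move=> ru rv; apply: (rational_mx_atM _ rv).
by apply: rational_mx_atM (rational_mx_at_cst _ _); exact: rational_mx_at_tr.
Qed.

(** * The risk along the ridge path *)

Section RidgePath.
Context {R : realType} {n p : nat}.
Variables (X : 'M[R]_(n, p)) (y : 'cV[R]_n) (K : 'M[R]_(1 + p)).
Hypothesis K_sym : K^T = K.
Implicit Types (a l xi : R) (b : 'cV[R]_p).

(** Coefficients of the residual y0 - x0^T b, and of - x0^T b, in the stacked
    random vector (y0, x0). Treating y0 as one more coordinate makes every risk
    a homogeneous quadratic form. *)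
Definition residual_coef b : 'cV[R]_(1 + p) := col_mx 1%:M (- b).
Definition signal_coef b : 'cV[R]_(1 + p) := col_mx 0 (- b).

Lemma residual_coefB b b' t :
  residual_coef (b - t *: b') = residual_coef b + (- t) *: signal_coef b'.
Proof.
rewrite /residual_coef /signal_coef scale_col_mx add_col_mx scaler0 addr0.
by rewrite opprB scalerN scaleNr opprK addrC.
Qed.

Lemma signal_coefZ b t : signal_coef (t *: b) = t *: signal_coef b.
Proof. by rewrite /signal_coef scale_col_mx scaler0 scalerN. Qed.

Definition path_risk l : R :=
  bform K (residual_coef (ridge_coef X y l)) (residual_coef (ridge_coef X y l)).

Lemma rational_at_ridge_coef a : 0 < a -> rational_mx_at a (ridge_coef X y).
Proof.
move=> a0; apply: rational_mx_atM; first exact: rational_at_resolvent.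
exact: rational_mx_at_cst.
Qed.

Lemma rational_at_path_risk a : 0 < a -> rational_at a path_risk.
Proof.
move=> a0; apply: rational_at_bform; apply: rational_mx_at_col;
  by [exact: rational_mx_at_cst|apply: rational_mx_atN;
      exact: rational_at_ridge_coef].
Qed.

Lemma rational_at_drift_form a : 0 < a -> rational_at a
  (fun l => l ^+ 2 * bform K (signal_coef (ridge_drift X y l))
                             (signal_coef (ridge_drift X y l))).
Proof.
move=> a0; apply: rational_atM; first exact: rational_atX (rational_at_id a).
by apply: rational_at_bform; apply: rational_mx_at_col;
  by [exact: rational_mx_at_cst|apply: rational_mx_atN; apply: rational_mx_atM;
   [exact: rational_at_resolvent|exact: rational_at_ridge_coef]].
Qed.

(** By the resolvent identity, path_risk l - path_risk a is exactly l - a times a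
    rational germ, whose value at a is the derivative. *)
Lemma derive1_path_risk a : 0 < a -> derive1 path_risk a =
  - (2 * bform K (residual_coef (ridge_coef X y a))
                 (signal_coef (ridge_drift X y a))).
Proof.
move=> a0; pose v l := signal_coef (resolvent X l *m ridge_coef X y a).
set rho := residual_coef (ridge_coef X y a).
pose g l := - (2 * bform K rho (v l)) + (l - a) * bform K (v l) (v l).
have rv : rational_mx_at a v.
  apply: rational_mx_at_col; first exact: rational_mx_at_cst.
  apply: rational_mx_atN; apply: rational_mx_atM.
    exact: rational_at_resolvent.
  exact: rational_mx_at_cst.
have rg : rational_at a g.
  apply: rational_atD.
    apply: rational_atN; apply: rational_atM; first exact: rational_at_cst.
    by apply: rational_at_bform => //; exact: rational_mx_at_cst.
  apply: rational_atM; last exact: rational_at_bform.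
  exact: rational_atB (rational_at_id a) (rational_at_cst a a).
have gE : \forall l \near a, path_risk l = path_risk a + (l - a) * g l.
  near=> l; have l0 : 0 < l by near: l; exact: lt_nbhsr.
  rewrite /path_risk (ridge_coef_slope X y a0 l0) residual_coefB.
  by rewrite bform_line// /g -/rho -/(v l); ring.
by rewrite (derive1_of_slope rg gE) /g subrr mul0r addr0.
Unshelve. all: by end_near. Qed.

Lemma path_risk_drift l xi : 0 < l ->
  let b := ridge_coef X y l - (xi * l) *: ridge_drift X y l in
  bform K (residual_coef b) (residual_coef b) =
  path_risk l + xi * (l * derive1 path_risk l) +
  xi ^+ 2 * (l ^+ 2 * bform K (signal_coef (ridge_drift X y l))
                              (signal_coef (ridge_drift X y l))).
Proof.
move=> l0 /=; rewrite derive1_path_risk// residual_coefB bform_line//.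
by rewrite /path_risk; ring.
Qed.

End RidgePath.

(** * The curvature criterion for self-distillation *)

Theorem proposition2p3 (R : realType) (n p : nat)
    (X : 'M[R]_(n, p)) (y : 'cV[R]_n)
    (d : measure_display) (T : measurableType d) (P : probability T R)
    (x0 : T -> 'cV[R]_p) (y0 : T -> R) (lstar : R) :
  (0 < n)%N ->
  (forall i : 'I_p, measurable_fun [set: T] (fun w => x0 w i 0)) ->
  measurable_fun [set: T] y0 ->
  ('E_P[fun w => (y0 w ^+ 2)%R] < +oo)%E ->
  ('E_P[fun w => sqnorm (x0 w)] < +oo)%E ->
  let risk_l := ridge_risk P x0 y0 X y in
  let risk_sd := sd_risk_opt P x0 y0 X y in
  let D := discrepancy P x0 X y in
  argmin_on [set l : R | 0 < l] risk_l lstar ->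
  D lstar < lstar ^+ 2 / 2 * derive1n 2 risk_l lstar ->
  [/\ (* negative curvature at lstar *)
      0 < D lstar ->
        twice_derivable_at risk_sd lstar /\ derive1n 2 risk_sd lstar < 0,
      (* degenerate case: risk_sd is discontinuous at lstar, and its curvature
         there is -oo *)
      D lstar = 0 -> second_difference risk_sd lstar h @[h --> 0^'] --> -oo
    & inf [set risk_sd l | l in [set l : R | 0 < l]]
        < inf [set risk_l l | l in [set l : R | 0 < l]]].
Proof.
move=> n0 mx0 my0 y0L2 x0L2 r s D [/= a0 rmin] test.
pose Z w : 'cV[R]_(1 + p) := col_mx (y0 w)%:M (x0 w).
have ZL2 i : square_integrable P (fun w => Z w i 0).
  case: (splitP i) => k ik.
    have -> : i = lshift p k by apply: val_inj.
    under eq_fun do rewrite col_mxEu ord1 mxE eqxx mulr1n.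
    by apply: square_integrableP => //; move: y0L2; rewrite unlock.
  have -> : i = rshift 1 k by apply: val_inj.
  under eq_fun do rewrite col_mxEd.
  apply: square_integrableP => //; move: x0L2; rewrite unlock.
  apply: le_lt_trans; apply: ge0_le_integral => //.
  - by move=> w _; rewrite lee_fin sqr_ge0.
  - by apply/measurable_EFinP; exact: measurable_funX.
  - apply/measurable_EFinP; apply: measurable_sum => j.
    exact: measurable_funX.
  - move=> w _; rewrite lee_fin /sqnorm (bigD1 k)//= lerDl.
    by apply: sumr_ge0 => j _; exact: sqr_ge0.
pose K := second_moment P Z.
have K_sym : K^T = K := second_moment_sym P Z.
have riskE b : risk P x0 y0 (linear_predictor b) =
    bform K (residual_coef b) (residual_coef b).
  rewrite /bform -second_moment_quadratic// /risk unlock.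
  apply: eq_Rintegral => w _; congr (_ ^+ 2).
  rewrite /Z /residual_coef tr_col_mx mul_row_col tr_scalar_mx mulmx1.
  by rewrite mulmxN [RHS]mxE [X in _ = X + _]mxE eqxx mulr1n [X in _ = _ + X]mxE.
have signalE b : \int[P]_w (linear_predictor b (x0 w) ^+ 2) =
    bform K (signal_coef b) (signal_coef b).
  rewrite /bform -second_moment_quadratic//.
  apply: eq_Rintegral => w _.
  rewrite /Z /signal_coef tr_col_mx mul_row_col mulmx0 add0r mulmxN.
  by rewrite [in RHS]mxE sqrrN.
have DE l : 0 < l -> D l = l ^+ 2 * bform K (signal_coef (ridge_drift X y l))
                                        (signal_coef (ridge_drift X y l)).
  move=> l0.
  transitivity (\int[P]_w (linear_predictor (l *: ridge_drift X y l) (x0 w) ^+ 2)).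
    rewrite /D /discrepancy unlock; apply: eq_Rintegral => w _.
    rewrite ridgeE// pd_ridgeE//; congr (_ ^+ 2).
    by rewrite /linear_predictor mulmxBr !mxE; ring.
  by rewrite signalE signal_coefZ bformZr (bformC K_sym) bformZr; ring.
have rE l : 0 < l -> r l = path_risk X y K l.
  by move=> l0; rewrite /r /ridge_risk ridgeE.
have lnear (l : R) : 0 < l -> \forall z \near l, 0 < z by move=> l0; exact: lt_nbhsr.
have rr : rational_at lstar r.
  apply: rational_at_near (rational_at_path_risk X y K a0).
  by near=> l; rewrite rE//; near: l; exact: lnear.
have rD : rational_at lstar D.
  apply: rational_at_near (rational_at_drift_form X y K a0).
  by near=> l; rewrite DE//; near: l; exact: lnear.
have r'E l : 0 < l -> derive1 r l = derive1 (path_risk X y K) l.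
  move=> l0; rewrite !derive1E; apply: near_eq_derive.
  by near=> z; apply: rE; near: z; exact: lnear.
apply: (@curvature_test _ r D (fun l xi => risk P x0 y0 (sd_ridge X y l xi))) => //.
- move=> l; rewrite /D /discrepancy fine_ge0// expectation_ge0// => w.
  exact: sqr_ge0.
- move=> l xi; rewrite /risk fine_ge0// expectation_ge0// => w.
  exact: sqr_ge0.
- move=> l xi l0; rewrite sd_ridgeE// riskE path_risk_drift//.
  by rewrite rE// r'E// DE.
Unshelve. all: by end_near. Qed.
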